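(* Let $\{\omega_n:n\in\mathbb{N}_0\}$ and $\{\tilde\omega_n:n\in\mathbb{N}_0\}$ be the wavelet packets (defined in the context) with respect to a pair of biorthogonal scaling functions $\omega_0=\varphi$ and $\tilde\omega_0=\tilde\varphi$. Then $$\langle\omega_\ell(\cdot),\tilde\omega_n(\cdot-u(k))\rangle=\delta_{\ell,n}\,\delta_{0,k}\quad\text{for all }\ell,n,k\in\mathbb{N}_0.$$
   Context: $K$ is a local field of positive characteristic $p$ with ring of integers $\mathfrak{D}=\{|x|\le1\}$, prime ideal $\mathfrak{B}=\mathfrak{p}\mathfrak{D}$ ($\mathfrak{p}$ a prime element), $q=|\mathfrak{D}/\mathfrak{B}|=p^c$, Haar measure normalized with $\mathfrak{D}$ of measure $1$. Choose $\zeta_0=1,\zeta_1,\dots,\zeta_{c-1}\in\mathfrak{D}$ with $|\zeta_j|=1$ whose images form a basis of $\mathfrak{D}/\mathfrak{B}\cong GF(q)$ over $GF(p)$; for $0\le n<q$, $n=a_0+a_1p+\dots+a_{c-1}p^{c-1}$ ($0\le a_k<p$), put $u(n)=(a_0+a_1\zeta_1+\dots+a_{c-1}\zeta_{c-1})\mathfrak{p}^{-1}$, and for $n=b_0+b_1q+\dots+b_sq^s$ ($0\le b_k<q$), $u(n)=u(b_0)+u(b_1)\mathfrak{p}^{-1}+\dots+u(b_s)\mathfrak{p}^{-s}$. $\chi$ is a character of $(K,+)$ trivial on $\mathfrak{D}$, non-trivial on $\mathfrak{B}^{-1}$, $\chi_k(x)=\chi(u(k)x)$; $\hat f(\xi)=\int_Kf(x)\overline{\chi(\xi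 x)}dx$. Let $\varphi,\tilde\varphi\in L^2(K)$ and $\psi_\ell,\tilde\psi_\ell\in L^2(K)$ ($1\le\ell\le q-1$) satisfy $\varphi(x)=\sqrt q\sum_{k\in\mathbb{N}_0}a_k^0\varphi(\mathfrak{p}^{-1}x-u(k))$, $\psi_\ell(x)=\sqrt q\sum_ka_k^\ell\varphi(\mathfrak{p}^{-1}x-u(k))$, and the same with tildes (coefficients $\tilde a_k^s$), all coefficient sequences in $\ell^2(\mathbb{N}_0)$; masks $m_s(\xi)=\frac1{\sqrt q}\sum_ka_k^s\overline{\chi_k(\xi)}$, $\tilde m_s$ analogously ($0\le s\le q-1$). $\varphi$ is the scaling function of a multiresolution analysis of $L^2(K)$ and $\{\psi_\ell(\cdot-u(k))\}$ is a Riesz basis of a direct complement $W_0$ of $V_0$ in $V_1$. Biorthogonality: for all $k\in\mathbb{N}_0$, $1\le\ell,\ell'\le q-1$: $\langle\varphi,\tilde\varphi(\cdot-u(k))\rangle=\delta_{0,k}$, $\langle\varphi,\tilde\psi_\ell(\cdot-u(k))\rangle=0$, $\langle\tilde\varphi,\psi_\ell(\cdot-u(k))\rangle=0$, $\langle\psi_\ell,\tilde\psi_{\ell'}(\cdot-u(k))\rangle=\delta_{\ell,\ell'}\delta_{0,k}$. Wavelet packets: $\omega_0=\varphi$, $\tilde\omega_0=\tilde\varphi$, and for $n=qr+s$ with $r\in\mathbb{N}_0$, $0\le s\le q-1$: $\omega_n(x)=\sqrt q\sum_{k\in\mathbb{N}_0}a_k^s\omega_r(\mathfrak{p}^{-1}x-u(k))$,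 $\tilde\omega_n(x)=\sqrt q\sum_k\tilde a_k^s\tilde\omega_r(\mathfrak{p}^{-1}x-u(k))$. *)

(* Defs.v *)
From HB Require Import structures.
From mathcomp Require Import all_boot all_order all_algebra.
From mathcomp Require Import all_classical all_reals all_analysis.
From mathcomp Require Import complex.
Set Implicit Arguments. Unset Strict Implicit. Unset Printing Implicit Defensive.
Import Order.TTheory GRing.Theory Num.Theory.
Local Open Scope ring_scope.
Local Open Scope classical_set_scope.

(** K viewed as a pointed type (base point 0), needed for measurable types *)
Definition Kpt (K : fieldType) : Type := K.
HB.instance Definition _ (K : fieldType) := Choice.on (Kpt K).
HB.instance Definition _ (K : fieldType) := isPointed.Build (Kpt K) 0.

Section LocalFieldDefs.
Variables (R : realType) (K : fieldType).

(** Standing data of the paper: a local field K of positive characteristic p,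
    absolute value [abs], prime element [pr] (the paper's frak p),
    q = p^c = |D/B|, units zeta_0 = 1, zeta_1, ..., zeta_(c-1) whose residues
    form a basis of D/B = GF(q) over GF(p). *)
Record local_field_pchar (p c : nat) (abs : K -> R) (pr : K) (zeta : nat -> K)
  : Prop := {
  lf_prime : prime p;
  lf_char : (p%:R : K) = 0;
  lf_abs_ge0 : forall x, 0 <= abs x;
  lf_abs_eq0 : forall x, abs x = 0 <-> x = 0;
  lf_absM : forall x y, abs (x * y) = abs x * abs y;
  lf_abs_ultra : forall x y, abs (x + y) <= Num.max (abs x) (abs y);
  (* completeness w.r.t. abs *)
  lf_complete : forall s : nat -> K,
    (forall e : R, 0 < e -> exists N : nat, forall m n : nat,
        (N <= m)%N -> (N <= n)%N -> abs (s m - s n) < e) ->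
    exists l : K, forall e : R, 0 < e -> exists N : nat, forall n : nat,
        (N <= n)%N -> abs (s n - l) < e;
  (* pr is a prime element: a generator of B = {|x| < 1} (discrete valuation) *)
  lf_pr_neq0 : pr != 0;
  lf_pr_lt1 : abs pr < 1;
  lf_pr_gen : forall x, abs x < 1 -> abs x <= abs pr;
  (* normalisation of the absolute value: |pr| = q^-1 *)
  lf_pr_norm : abs pr = ((p ^ c)%N%:R)^-1;
  (* the zeta_j *)
  lf_zeta0 : zeta 0%N = 1;
  lf_zeta_unit : forall j, (j < c)%N -> abs (zeta j) = 1;
  (* residue field D/B: every x in D is congruent mod B to exactly one
     GF(p)-combination of zeta_0..zeta_(c-1), i.e. the residues of the zeta_j
     form a basis of D/B over GF(p), so |D/B| = p^c = q (finite). *)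
  lf_residue : forall x, abs x <= 1 ->
    exists! a : {ffun 'I_c -> 'I_p},
      abs (x - \sum_(j < c) (nat_of_ord (a j))%:R * zeta j) < 1
}.

(** open sets of the topology of abs, Borel sigma-algebra *)
Definition lf_open (abs : K -> R) : set (set (Kpt K)) :=
  [set A | forall x, A x -> exists2 r : R, 0 < r &
             forall y, abs (y - x) < r -> A y].

End LocalFieldDefs.
Notation Kmeas abs := (g_sigma_algebraType (lf_open abs)).
Section LocalFieldDefs2.
Variables (R : realType) (K : fieldType).

(** normalized Haar measure: translation invariant, measure of D is 1 *)
Definition haar_normalized (abs : K -> R)
  (mu : {measure set (Kmeas abs) -> \bar R}) : Prop :=
  (forall (a : K) (A : set K), measurable (A : set (Kmeas abs)) ->
      mu ([set x + a | x in A] : set (Kmeas abs)) = mu A) /\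
  mu ([set x | abs x <= 1] : set (Kmeas abs)) = 1%E.

(** the enumeration u : N_0 -> K of the paper *)
Definition u_digit (p c : nat) (pr : K) (zeta : nat -> K) (n : nat) : K :=
  (\sum_(j < c) ((n %/ p ^ j) %% p)%N%:R * zeta j) / pr.

Definition uK (p c : nat) (pr : K) (zeta : nat -> K) (n : nat) : K :=
  \sum_(k < n.+1)
     u_digit p c pr zeta ((n %/ (p ^ c) ^ k) %% (p ^ c))%N * pr ^- k.

(** complex-valued functions, L^2(K) *)
Local Notation C := (R[i]).

Definition sqn (z : C) : R := complex.Re z ^+ 2 + complex.Im z ^+ 2.

Definition nrm2 (abs : K -> R) (mu : {measure set (Kmeas abs) -> \bar R})
  (f : K -> C) : \bar R := (\int[mu]_x (sqn (f x))%:E)%E.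

Definition L2 (abs : K -> R) (mu : {measure set (Kmeas abs) -> \bar R})
  (f : K -> C) : Prop :=
  measurable_fun (setT : set (Kmeas abs)) (fun x => complex.Re (f x)) /\
  measurable_fun (setT : set (Kmeas abs)) (fun x => complex.Im (f x)) /\
  (nrm2 mu f < +oo)%E.

(** <f, g> = int_K f(x) conj(g(x)) dx *)
Definition inner (abs : K -> R) (mu : {measure set (Kmeas abs) -> \bar R})
  (f g : K -> C) : C :=
  Complex (Rintegral mu setT (fun x : Kmeas abs => complex.Re (f x * (g x)^*)))
          (Rintegral mu setT (fun x : Kmeas abs => complex.Im (f x * (g x)^*))).

Definition transl (f : K -> C) (a : K) : K -> C := fun x => f (x - a).

(** partial sums sqrt q * sum_(k<N) a_k f(pr^-1 x - u(k)) *)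
Definition refine_sum (q : nat) (pr : K) (u : nat -> K) (a : nat -> C)
  (f : K -> C) (N : nat) : K -> C :=
  fun x => (Num.sqrt (q%:R : R))%:C%C * \sum_(k < N) a k * f (pr^-1 * x - u k).

(** convergence in L^2(K) *)
Definition L2_lim (abs : K -> R) (mu : {measure set (Kmeas abs) -> \bar R})
  (S : nat -> K -> C) (f : K -> C) : Prop :=
  (fun N => nrm2 mu (fun x => S N x - f x)) @ \oo --> 0%E.

(** f = sqrt q sum_k a_k g(pr^-1 . - u(k)) in L^2(K) *)
Definition refinement (abs : K -> R) (mu : {measure set (Kmeas abs) -> \bar R})
  (q : nat) (pr : K) (u : nat -> K) (f : K -> C) (a : nat -> C) (g : K -> C)
  : Prop := L2_lim mu (refine_sum q pr u a g) f.

Definition l2seq (a : nat -> C) : Prop :=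
  exists M : R, forall N : nat, \sum_(k < N) sqn (a k) <= M.

Definition closed_subspace (abs : K -> R)
  (mu : {measure set (Kmeas abs) -> \bar R}) (V : set (K -> C)) : Prop :=
  [/\ forall f, V f -> L2 mu f,
      V (fun _ => 0),
      forall f g, V f -> V g -> V (fun x => f x + g x),
      forall (c : C) f, V f -> V (fun x => c * f x) &
      forall f, L2 mu f ->
        (forall e : R, 0 < e -> exists2 g, V g &
            (nrm2 mu (fun x => (f x - g x)%R) < e%:E)%E) -> V f].

Definition comb (I : eqType) (s : seq I) (c : I -> C) (e : I -> K -> C)
  : K -> C := fun x => \sum_(i <- s) c i * e i x.

(** {e_i : P i} is a Riesz basis of the closed subspace V *)
Definition riesz_basis (abs : K -> R) (mu : {measure set (Kmeas abs) -> \bar R})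
  (I : eqType) (P : pred I) (e : I -> K -> C) (V : set (K -> C)) : Prop :=
  [/\ closed_subspace mu V,
      forall i, P i -> V (e i),
      forall f, V f -> forall eps : R, 0 < eps ->
        exists (s : seq I) (c : I -> C), all P s /\
          (nrm2 mu (fun x => (f x - comb s c e x)%R) < eps%:E)%E &
      exists A B : R, [/\ 0 < A, A <= B &
        forall (s : seq I) (c : I -> C), uniq s -> all P s ->
          (((A * \sum_(i <- s) sqn (c i))%R)%:E <= nrm2 mu (comb s c e))%E /\
          (nrm2 mu (comb s c e) <= ((B * \sum_(i <- s) sqn (c i))%R)%:E)%E]].

(** phi is the scaling function of the MRA (V_j)_(j in Z) of L^2(K) *)
Definition MRA (abs : K -> R) (mu : {measure set (Kmeas abs) -> \bar R})
  (pr : K) (u : nat -> K) (V : int -> set (K -> C)) (phi : K -> C) : Prop :=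
  [/\ (forall j, closed_subspace mu (V j)) /\
        (forall j, V j `<=` V (j + 1)%R),
      forall f, L2 mu f -> forall eps : R, 0 < eps ->
        exists (j : int) (g : K -> C), V j g /\
          (nrm2 mu (fun x => (f x - g x)%R) < eps%:E)%E,
      forall f, (forall j, V j f) -> nrm2 mu f = 0%E,
      forall j f, V j f <-> V (j + 1)%R (fun x => f (pr^-1 * x)) &
      riesz_basis mu predT (fun k : nat => transl phi (u k)) (V 0%R)].

(** W is a direct complement of V0 in V1 *)
Definition direct_complement (abs : K -> R)
  (mu : {measure set (Kmeas abs) -> \bar R}) (W V0 V1 : set (K -> C)) : Prop :=
  [/\ closed_subspace mu W, W `<=` V1,
      forall f, V0 f -> W f -> nrm2 mu f = 0%E &
      forall f, V1 f -> exists g h, [/\ V0 g, W h & f = (fun x => g x + h x)]].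

End LocalFieldDefs2.

(* Main.v *)
(** Dilating by [pr^-1] multiplies Haar measure by a constant, and the range of
    [u] is a subgroup of [K] stable under multiplication by [pr^-1].  Hence the
    inner product of two partial refinement sums, the second one translated by
    [u k], is a fixed expression in the numbers <f, g(. - u m)>, where [f] and
    [g] are the refined functions.  Write l = q r + s and n = q r' + s'.  By
    induction on l + n these numbers are known for f = omega_r and
    g = omega'_r': if r <> r' they all vanish; if r = r' they coincide with
    those of phi and phi', so that <omega_l, omega'_n(. - u k)> equals the
    corresponding inner product of the members s and s' of the initial
    biorthogonal families (phi, psi) and (phi', psi').

    The behaviour of Haar measure under dilation follows from its uniqueness:
    the sets x + pr^k D form a pi-system generating the Borel sets, and their
    measure is forced by translation invariance. *)

Require Import Defs.
From HB Require Import structures.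
From mathcomp Require Import all_boot all_order all_algebra.
From mathcomp Require Import all_classical all_reals all_analysis.
From mathcomp Require Import complex.
From mathcomp Require Import measurable_realfun.
From mathcomp Require Import ring lra.
Import Order.TTheory GRing.Theory Num.Theory.
Local Open Scope ring_scope.
Local Open Scope classical_set_scope.

Set Implicit Arguments.
Unset Strict Implicit.
Unset Printing Implicit Defensive.

(** * The enumeration of coset representatives *)

Section Enumeration.
Variables (K : fieldType) (p c : nat) (pr : K) (zeta : nat -> K).
Hypotheses (p_gt0 : (0 < p)%N) (q_gt1 : (1 < p ^ c)%N).
Hypothesis pchar : (p%:R : K) = 0.

Local Notation q := (p ^ c)%N.
Local Notation dig := (u_digit p c pr zeta).
Local Notation u := (uK p c pr zeta).

(** By induction on [m]: a number realizing the shifted sequence is multiplied by p and receives the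
    new lowest digit. *)
Lemma digits_exist (m : nat) (e : nat -> nat) :
  exists2 n, (n < p ^ m)%N & forall j, (j < m)%N -> ((n %/ p ^ j) %% p = e j %% p)%N.
Proof.
elim: m e => [|m IH] e; first by exists 0%N.
have [n ltn en] := IH (fun j => e j.+1).
have e0p : (e 0%N %% p < p)%N by rewrite ltn_mod.
exists (n * p + e 0%N %% p)%N.
  rewrite expnSr; apply: (@leq_trans (n.+1 * p)%N); last by rewrite leq_mul2r ltn orbT.
  by rewrite mulSn addnC ltn_add2r.
case=> [|j] jm; first by rewrite expn0 divn1 modnMDl modn_mod.
by rewrite expnS divnMA divnMDl // (divn_small e0p) addn0 en.
Qed.

Lemma natr_mod_pchar (n : nat) : (n %% p)%N%:R = n%:R :> K.
Proof. by rewrite [in RHS](divn_eq n p) natrD natrM pchar mulr0 add0r. Qed.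

Lemma u_digit0 : dig 0 = 0.
Proof. by rewrite /u_digit big1 ?mul0r // => j _; rewrite div0n mod0n mul0r. Qed.

(** Base-p digits are added modulo p without carrying; characteristic p makes the reduction
    invisible in K. *)
Lemma u_digitD (m n : nat) : exists2 t, (t < q)%N & dig t = dig m + dig n.
Proof.
have [t ltq et] := digits_exist c (fun j => (m %/ p ^ j) %% p + (n %/ p ^ j) %% p)%N.
exists t => //; rewrite /u_digit -mulrDl -big_split /=; congr (_ / _).
apply: eq_bigr => j _.
by rewrite et // natr_mod_pchar natrD mulrDl.
Qed.

(** Positions k > n contribute nothing, since n < k < q^k makes the digit 0. Hence the range of
    summation may be enlarged at will. *)
Lemma uK_widen (n N : nat) : (n < N)%N ->
  u n = \sum_(k < N) dig ((n %/ q ^ k) %% q)%N * pr ^- k.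
Proof.
move=> nN; rewrite /uK (big_ord_widen N (fun k => dig ((n %/ q ^ k) %% q)%N * pr ^- k)) //.
rewrite [in RHS](bigID (fun k : 'I_N => (k < n.+1)%N)) /= [X in _ + X]big1 ?addr0 //.
move=> k; rewrite -ltnNge ltnS => nk.
rewrite divn_small ?mod0n ?u_digit0 ?mul0r //.
by apply: (leq_trans nk); exact: ltnW (ltn_expl k q_gt1).
Qed.

Lemma uK_rec (n : nat) : u n = dig (n %% q)%N + pr^-1 * u (n %/ q)%N.
Proof.
(* Splitting off the first of n + 2 terms leaves n + 1, enough for the quotient, which is at most
   n. *)
rewrite (@uK_widen n n.+2) // big_ord_recl /= expn0 divn1 expr0 invr1 mulr1.
congr (_ + _); rewrite (@uK_widen (n %/ q) n.+1) ?ltnS ?leq_div // big_distrr /=.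
apply: eq_bigr => k _; rewrite /bump /= add1n expnS divnMA exprS invfM.
by rewrite mulrCA.
Qed.

Lemma uK0 : u 0 = 0.
Proof. by rewrite (@uK_widen 0 1) // big_ord1 div0n mod0n u_digit0 mul0r. Qed.

Lemma uK_shift (n : nat) : exists m, u m = pr^-1 * u n.
Proof.
exists (n * q)%N; rewrite uK_rec mulnK ?(ltnW q_gt1) //.
by rewrite modnMl u_digit0 add0r.
Qed.

(** Induction on m + n through [uK_rec]: the lowest base-q digits combine without carry by
    [u_digitD], and the quotients by the induction hypothesis. *)
Lemma uKD (m n : nat) : exists t, u t = u m + u n.
Proof.
have [b] := ubnP (m + n); elim: b m n => // b IH m n mnb.
have q0 : (0 < q)%N by exact: ltnW.
have [|mn0] := posnP (m + n).
  by move=> /eqP; rewrite addn_eq0 => /andP[/eqP-> /eqP->]; exists 0%N; rewrite uK0 addr0.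
have lt_mn : (m %/ q + n %/ q < m + n)%N.
  case: (posnP m) mn0 => [-> /=|m0 _].
    by rewrite div0n !add0n => n0; exact: ltn_Pdiv.
  by rewrite -addSn leq_add ?ltn_Pdiv ?leq_div.
have [v uv] := IH _ _ (leq_trans lt_mn mnb).
have [t tq dt] := u_digitD (m %% q) (n %% q).
exists (v * q + t)%N; rewrite uK_rec divnMDl // (divn_small tq) addn0.
rewrite modnMDl (modn_small tq) dt uv (uK_rec m) (uK_rec n) mulrDr.
by rewrite addrACA.
Qed.

(** In characteristic p the opposite of u n is (p - 1) u n, a repeated sum of values of u. *)
Lemma uKN (n : nat) : exists t, u t = - u n.
Proof.
have H : forall k, exists t, u t = u n *+ k.
  elim=> [|k [t ut]]; first by exists 0%N; rewrite uK0 mulr0n.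
  by have [t' ut'] := uKD n t; exists t'; rewrite ut' ut mulrS.
have [t ut] := H p.-1; exists t; rewrite ut; apply/eqP; rewrite -addr_eq0.
by rewrite -mulrSr prednK // -mulr_natr pchar mulr0.
Qed.

End Enumeration.

(** * Haar measure and dilations *)

Section Haar.
Variables (R : realType) (K : fieldType) (p c : nat) (abs : K -> R) (pr : K).
Variable zeta : nat -> K.
Hypothesis lf : local_field_pchar p c abs pr zeta.

Let absM := lf_absM lf.
Let abs_ge0 := lf_abs_ge0 lf.

Lemma abs0 : abs 0 = 0.
Proof. exact/(lf_abs_eq0 lf). Qed.

Lemma abs_neq0 x : x != 0 -> abs x != 0.
Proof. by apply: contra_neq => /(lf_abs_eq0 lf). Qed.

Lemma abs1 : abs 1 = 1.
Proof.
apply: (mulfI (abs_neq0 (oner_neq0 K))).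
by rewrite -absM !mulr1.
Qed.

Lemma absN x : abs (- x) = abs x.
Proof.
rewrite -mulN1r absM; suff -> : abs (-1) = 1 by rewrite mul1r.
apply/eqP; rewrite -(@eqrXn2 _ 2) // ?abs_ge0 //.
by rewrite expr2 -absM mulrNN mulr1 abs1 expr1n.
Qed.

Lemma abs_distC x y : abs (x - y) = abs (y - x).
Proof. by rewrite -absN opprB. Qed.

Lemma abs_exp x n : abs (x ^+ n) = abs x ^+ n.
Proof. by elim: n => [|n IH]; rewrite ?expr0 ?abs1 // !exprS absM IH. Qed.

Lemma abs_le_add r x y : abs x <= r -> abs y <= r -> abs (x + y) <= r.
Proof. by move=> xr yr; rewrite (le_trans (lf_abs_ultra lf x y)) // ge_max xr. Qed.

Lemma abs_pr_gt0 : 0 < abs pr.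
Proof. by rewrite lt_neqAle abs_ge0 eq_sym (abs_neq0 (lf_pr_neq0 lf)). Qed.

Lemma abs_prX_gt0 k : 0 < abs pr ^+ k.
Proof. exact: exprn_gt0 abs_pr_gt0. Qed.

(** Since 0 < |pr| < 1 and |pr| = q^-1, neither q = 1 nor q = 0 is possible; in the latter case the
    inverse would be 0 by convention. *)
Lemma card_residue_gt1 : (1 < p ^ c)%N.
Proof.
move: (lf_pr_lt1 lf); rewrite (lf_pr_norm lf) ltnNge; apply: contraTN => q1.
rewrite -leNgt; case: (p ^ c)%N q1 (lf_pr_norm lf) => [|[|//]] _ h; last by rewrite invr1.
by move: abs_pr_gt0; rewrite h invr0 ltxx.
Qed.

Lemma abs_prX_small (e : R) : 0 < e -> exists k, abs pr ^+ k < e.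
Proof.
move=> e0; pose k := Num.Def.archi_bound e^-1; exists k.
have ek : e^-1 < k%:R by apply: archi_boundP; rewrite invr_ge0 ltW.
rewrite (lf_pr_norm lf) exprVn -[e]invrK ltf_pV2 ?qualifE /= ?invr_gt0 //; last first.
  by rewrite exprn_gt0 // ltr0n (ltnW card_residue_gt1).
by apply: (lt_le_trans ek); rewrite -natrX ler_nat ltnW // ltn_expl // card_residue_gt1.
Qed.

(** * Balls, a countable dense set, and the Borel sets of K *)

Definition digit_comb (d : {ffun 'I_c -> 'I_p}) : K :=
  \sum_(j < c) (nat_of_ord (d j))%:R * zeta j.

Lemma abs_digit_comb d : abs (digit_comb d) <= 1.
Proof.
rewrite /digit_comb; elim/big_ind: _ => [|x y|j _]; first by rewrite abs0.
- exact: abs_le_add.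
- rewrite absM (lf_zeta_unit lf) // mulr1.
  elim: (nat_of_ord _) => [|n IH]; first by rewrite abs0.
  by rewrite -natr1; apply: abs_le_add; rewrite ?abs1.
Qed.

(** This is the coset x + pr^k D. *)
Definition cball (x : K) (k : nat) : set K := [set y | abs (y - x) <= abs pr ^+ k].

(** By the ultrametric inequality every point of a ball is a center of it. *)
Lemma cball_eq x y k : cball x k y -> cball y k = cball x k.
Proof.
move=> xy; apply/seteqP; split => z /= h; rewrite /cball /=.
- by rewrite -(subrKA y) abs_le_add.
- by rewrite -(subrKA x) abs_le_add // abs_distC.
Qed.

Lemma cball_le x k m : (k <= m)%N -> cball x m `<=` cball x k.
Proof.
move=> km y /= /le_trans; apply; apply: ler_wiXn2l => //.
exact: ltW (lf_pr_lt1 lf).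
Qed.

Lemma cball_open x k : lf_open abs (cball x k).
Proof.
move=> y xy; exists (abs pr ^+ k); first exact: abs_prX_gt0.
by move=> z zy; rewrite -(cball_eq xy); exact: ltW.
Qed.

Lemma measurable_cball x k : measurable (cball x k : set (Kmeas abs)).
Proof. by apply: sub_sigma_algebra; exact: cball_open. Qed.

Definition cballs : set (set (Kpt K)) :=
  [set A | A = set0 \/ exists x k, A = cball x k].

(** Two balls that meet can be recentered at a common point, and are then nested. Disjoint ones are
    the reason for having [set0] in [cballs]. *)
Lemma cballs_setI : setI_closed cballs.
Proof.
move=> A B [->|[x [k ->]]]; first by left; rewrite set0I.
move=> [->|[y [m ->]]]; first by left; rewrite setI0.
have [->|/set0P[z [xz yz]]] := eqVneq (cball x k `&` cball y m) set0; first by left.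
rewrite -(cball_eq xz) -(cball_eq yz); right.
have [km|/ltnW mk] := leqP k m.
- by exists z, m; apply/seteqP; split=> [t []//|t zt]; split => //; exact: cball_le km _ zt.
- by exists z, k; apply/seteqP; split=> [t []//|t zt]; split => //; exact: cball_le mk _ zt.
Qed.

(** A finite pr-adic expansion in Horner form, with digits among the representatives of D/B. *)
Fixpoint expansion (s : seq {ffun 'I_c -> 'I_p}) : K :=
  if s is d :: s' then digit_comb d + pr * expansion s' else 0.

Definition center (i : nat * seq {ffun 'I_c -> 'I_p}) : K :=
  pr ^- i.1 * expansion i.2.

(** Subtracting the residue digit leaves a multiple of pr; approximating the quotient by pr gains
    one factor |pr| per digit. *)
Lemma expansion_dense k x : abs x <= 1 ->
  exists s, abs (x - expansion s) <= abs pr ^+ k.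
Proof.
elim: k x => [|k IH] x x1; first by exists [::]; rewrite subr0 expr0.
have [d [xd _]] := lf_residue lf x1.
pose y := (x - digit_comb d) / pr.
have pr0 := lf_pr_neq0 lf.
have ypr : x - digit_comb d = pr * y by rewrite mulrC divfK.
have y1 : abs y <= 1.
  by rewrite -(ler_pM2l abs_pr_gt0) mulr1 -absM -ypr; exact: (lf_pr_gen lf).
have [s ys] := IH y y1; exists (d :: s) => /=.
by rewrite opprD addrA ypr -mulrBr absM exprS ler_pM2l // abs_pr_gt0.
Qed.

Lemma center_dense k x : exists i, cball (center i) k x.
Proof.
have [m hm] : exists m, abs (pr ^+ m * x) <= 1.
  have [->|x0] := eqVneq x 0; first by exists 0%N; rewrite mulr0 abs0.
  have ax : 0 < abs x by rewrite lt_neqAle eq_sym abs_neq0 // abs_ge0.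
  have [|m hm] := @abs_prX_small (abs x)^-1; first by rewrite invr_gt0.
  by exists m; rewrite absM abs_exp -ler_pdivlMr // div1r ltW.
(* The precision k + m compensates the division by pr^m that recovers x. *)
have [s hs] := expansion_dense (k + m) hm.
exists (m, s); rewrite /cball /center /=.
rewrite -(ler_pM2l (abs_prX_gt0 m)) -exprD addnC -abs_exp -absM mulrBr.
by rewrite mulVKf // expf_neq0 // (lf_pr_neq0 lf).
Qed.

Lemma open_cballs : lf_open abs `<=` <<s cballs >>.
Proof.
move=> A oA.
(* Putting the inclusion in A inside the set makes [F ik] a ball contained in A or empty, so that
   the union runs over a whole countable type. *)
pose F (ik : (nat * seq {ffun 'I_c -> 'I_p}) * nat) : set (g_sigma_algebraType cballs) :=
  [set y | cball (center ik.1) ik.2 `<=` A /\ cball (center ik.1) ik.2 y].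
rewrite (_ : A = \bigcup_ik F ik).
  apply: (@countable_bigcupT_measurable _ (g_sigma_algebraType cballs)) => //.
  move=> ik; apply: sub_sigma_algebra; rewrite /F.
  have [sA|nA] := pselect (cball (center ik.1) ik.2 `<=` A).
  - by right; exists (center ik.1), ik.2; apply/seteqP; split=> [y []|y].
  - by left; apply/seteqP; split=> [y []|y].
apply/seteqP; split=> [x Ax|x [ik _ [sA]]]; last exact: sA.
have [r r0 rA] := oA x Ax.
have [k kr] := abs_prX_small r0.
have [i xi] := center_dense k x.
exists (i, k) => //; split=> //=.
rewrite -(cball_eq xi) => y /= xy; apply: rA; exact: le_lt_trans xy kr.
Qed.

Lemma measurable_cballs : @measurable _ (Kmeas abs) = <<s cballs >>.
Proof.
apply/seteqP; split.
- by apply: smallest_sub; [exact: smallest_sigma_algebra|exact: open_cballs].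
- apply: smallest_sub; first exact: sigma_algebra_measurable.
  move=> A [->|[x [k ->]]]; first exact: measurable0.
  exact: measurable_cball.
Qed.

(** * Haar measure of balls *)

Section Measure.
Variable m : {measure set (Kmeas abs) -> \bar R}.
Hypothesis haar_m : haar_normalized m.

Lemma haar_cball0 x k : m (cball x k) = m (cball 0 k).
Proof.
rewrite -(haar_m.1 x _ (measurable_cball 0 k)); congr (m _).
apply/seteqP; split=> [y xy|_ [y /= y0 <-]].
- by exists (y - x); rewrite ?subrK // /cball /= subr0.
- by rewrite /cball /= addrK -[y]subr0.
Qed.

(** The residue of y / pr^k selects the coset of pr^(k+1) D; existence in [lf_residue] gives the
    covering, and its uniqueness gives disjointness in the next lemma. *)
Lemma cball_bigcup k :
  cball 0 k = \bigcup_(d : {ffun 'I_c -> 'I_p}) cball (pr ^+ k * digit_comb d) k.+1.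
Proof.
have prk : pr ^+ k != 0 by rewrite expf_neq0 // (lf_pr_neq0 lf).
apply/seteqP; split=> [y|y [d _]]; rewrite /cball /= subr0 => h.
- have y1 : abs (y / pr ^+ k) <= 1.
    by rewrite -(ler_pM2l (abs_prX_gt0 k)) -{1}abs_exp -absM mulrC divfK // mulr1.
  have [d [yd _]] := lf_residue lf y1; exists d => //=.
  rewrite -{1}(divfK prk y) [_ / _ * _]mulrC -mulrBr absM abs_exp exprSr.
  by rewrite ler_pM2l ?abs_prX_gt0 //; exact: (lf_pr_gen lf).
- rewrite -(subrK (pr ^+ k * digit_comb d) y); apply: abs_le_add.
    by apply: (le_trans h); apply: ler_wiXn2l => //; exact: ltW (lf_pr_lt1 lf).
  by rewrite absM abs_exp ler_piMr ?abs_digit_comb // ltW // abs_prX_gt0.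
Qed.

Lemma trivIset_cball k :
  trivIset setT (fun d : {ffun 'I_c -> 'I_p} => cball (pr ^+ k * digit_comb d) k.+1).
Proof.
have prk : pr ^+ k != 0 by rewrite expf_neq0 // (lf_pr_neq0 lf).
apply/trivIsetP => d e _ _; apply: contraNeq => /set0P[y [yd ye]].
have y1 : abs (y / pr ^+ k) <= 1.
  have : cball 0 k y by rewrite cball_bigcup; exists d.
  rewrite /cball /= subr0 => h.
  by rewrite -(ler_pM2l (abs_prX_gt0 k)) -{1}abs_exp -absM mulrC divfK // mulr1.
have near f : cball (pr ^+ k * digit_comb f) k.+1 y ->
    abs (y / pr ^+ k - digit_comb f) < 1.
  rewrite /cball /= -{1}(divfK prk y) [_ / _ * _]mulrC -mulrBr absM abs_exp exprSr.
  by rewrite ler_pM2l ?abs_prX_gt0 // => /le_lt_trans; apply; exact: (lf_pr_lt1 lf).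
have [f [_ uf]] := lf_residue lf y1.
by apply/eqP; rewrite -(uf d (near _ yd)) (uf e (near _ ye)).
Qed.

(** The ball pr^k D is a disjoint union of q translates of pr^(k+1) D, so each step divides the
    measure by q = |pr|^-1, starting from measure 1 for D. *)
Lemma haar_cball x k : m (cball x k) = (abs pr ^+ k)%:E.
Proof.
rewrite haar_cball0; elim: k => [|k IH].
  rewrite expr0 -(haar_m.2); congr (m _).
  by apply/seteqP; split => y; rewrite /cball /= subr0 expr0.
have : m (cball 0 k) = ((p ^ c)%:R%:E * m (cball 0 k.+1))%E.
  rewrite cball_bigcup measure_fin_bigcup //; last 3 first.
  - exact: finite_finset.
  - exact: trivIset_cball.
  - by move=> d _; exact: measurable_cball.
  rewrite (eq_fsbigr (fun=> m (cball 0 k.+1))); last by move=> d _; exact: haar_cball0.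
  have -> : [set: {ffun 'I_c -> 'I_p}] = [set` enum {ffun 'I_c -> 'I_p}].
    by apply/seteqP; split=> d //= _; rewrite mem_enum.
  rewrite -fsbig_seq ?enum_uniq // big_const_seq count_predT -cardE card_ffun !card_ord.
  elim: (p ^ c)%N => [|n IHn] /=; first by rewrite mul0e.
  by rewrite IHn -nat1r EFinD ge0_muleDl ?lee_fin // mul1e.
rewrite IH => h.
have q0 : (p ^ c)%:R != 0 :> R by rewrite pnatr_eq0 -lt0n (ltnW card_residue_gt1).
rewrite exprSr EFinM h {1}(lf_pr_norm lf) muleC muleA -EFinM mulVf // mul1e //.
Qed.

End Measure.

Lemma haar_unique (m1 m2 : {measure set (Kmeas abs) -> \bar R}) (A : set (Kmeas abs)) :
  haar_normalized m1 -> haar_normalized m2 -> measurable A -> m1 A = m2 A.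
Proof.
move=> h1 h2.
(* A countable cover of K by sets of finite measure: balls of radius 1 about all centers, and the
   empty set at integers that encode no center. *)
pose g (n : nat) : set (Kmeas abs) :=
  if @unpickle (nat * seq {ffun 'I_c -> 'I_p})%type n is Some i
  then cball (center i) 0 else set0.
apply: (@measure_unique _ R (Kmeas abs) cballs g).
- exact: measurable_cballs.
- exact: cballs_setI.
- by move=> n; rewrite /g; case: unpickle => [i|]; [right; exists (center i), 0%N|left].
- apply/seteqP; split=> // x _; have [i xi] := center_dense 0 x.
  by exists (pickle i) => //; rewrite /g pickleK.
- move=> _ [->|[x [k ->]]]; first by rewrite !measure0.
  by rewrite !haar_cball.
- move=> n; rewrite /g; case: unpickle => [i|]; last by rewrite measure0.
  by rewrite haar_cball // ltry.
Qed.

Lemma measurable_affine (b a : K) : b != 0 ->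
  measurable_fun (setT : set (Kmeas abs)) (fun x : Kmeas abs => (b * x - a : Kmeas abs)).
Proof.
move=> b0; apply: (@measurability _ _ (Kmeas abs) (Kmeas abs) setT _ (lf_open abs)) => //.
move=> _ [A oA <-]; rewrite setTI; apply: sub_sigma_algebra => x /= /oA[r r0 rA].
have ab : 0 < abs b by rewrite lt_neqAle eq_sym abs_neq0 // abs_ge0.
exists (r / abs b); first by rewrite divr_gt0.
move=> y; rewrite ltr_pdivlMr // => h; apply: rA.
by rewrite opprB addrA subrK -mulrBr absM mulrC.
Qed.

(** * Translation and dilation of Haar measure *)

Section Scaling.
Variable mu : {measure set (Kmeas abs) -> \bar R}.
Hypothesis haar_mu : haar_normalized mu.

Lemma haar_shift (a : K) (A : set (Kmeas abs)) : measurable A ->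
  mu ((fun x => x - a) @^-1` A) = mu A.
Proof.
move=> mA; rewrite -(haar_mu.1 a _ mA); congr (mu _).
apply/seteqP; split=> [y /= h|_ [y Ay <-]]; last by rewrite /= addrK.
by exists (y - a) => //; rewrite subrK.
Qed.

Let T (x : Kmeas abs) : Kmeas abs := pr^-1 * x.

Let mT : measurable_fun setT T.
Proof.
have := @measurable_affine pr^-1 0; rewrite invr_eq0 => /(_ (lf_pr_neq0 lf)).
by under eq_fun do rewrite subr0.
Qed.

Let dilated (A : set (Kmeas abs)) : \bar R := mu (T @^-1` A).

Let dilated0 : dilated set0 = 0%E.
Proof. by rewrite /dilated preimage_set0 measure0. Qed.

Let dilated_ge0 A : (0 <= dilated A)%E.
Proof. exact: measure_ge0. Qed.

Let dilated_sigma_additive : semi_sigma_additive dilated.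
Proof. exact: (@measure_semi_sigma_additive _ _ _ (pushforward mu T)). Qed.

HB.instance Definition _ := isMeasure.Build _ _ _ dilated
  dilated0 dilated_ge0 dilated_sigma_additive.

Lemma haar_dilation (A : set (Kmeas abs)) : measurable A ->
  mu ((fun x => pr^-1 * x) @^-1` A) = ((abs pr)%:E * mu A)%E.
Proof.
move=> mA; have pr0 := lf_pr_neq0 lf.
have q0 : 0 <= (abs pr)^-1 by rewrite invr_ge0 ltW // abs_pr_gt0.
(* The pushforward under [T], divided by |pr|, is again normalized: the preimage of D is pr D, of
   measure |pr|. Uniqueness then identifies it with [mu]. *)
have haar_nu : haar_normalized (mscale (NngNum q0) dilated).
  split=> [a B mB|]; rewrite /mscale /= /dilated.
  - have mTB : measurable (T @^-1` B) by rewrite -[X in measurable X]setTI; exact: mT.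
    (* Taking preimages under [T] turns translation by a into translation by pr a. *)
    congr (_ * _)%E; apply: etrans (haar_mu.1 (pr * a) _ mTB); congr (mu _).
    apply/seteqP; split=> [x [y By yx]|_ [y By <-]].
    + exists (pr * y); first by rewrite /T /= mulKf.
      by rewrite -mulrDr yx /T mulVKf.
    + by exists (T y) => //; rewrite /T mulrDr mulKf.
  - have TD : T @^-1` [set x | abs x <= 1] = cball 0 1.
      apply/seteqP; split=> x; rewrite /cball /T /= subr0 expr1 => h.
      + by rewrite -(mulVKf pr0 x) absM ler_piMr // ltW // abs_pr_gt0.
      + by rewrite -(ler_pM2l abs_pr_gt0) -absM mulVKf // mulr1.
    transitivity (((abs pr)^-1)%:E * mu (cball 0 1))%E; first by rewrite -TD.
    by rewrite haar_cball // -EFinM expr1 mulVf // gt_eqF // abs_pr_gt0.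
rewrite (haar_unique haar_mu haar_nu mA) /mscale /= muleA -EFinM.
by rewrite mulfV ?mul1e // gt_eqF // abs_pr_gt0.
Qed.

Lemma haar_affine (a : K) (A : set (Kmeas abs)) : measurable A ->
  mu ((fun x => pr^-1 * x - a) @^-1` A) = ((abs pr)%:E * mu A)%E.
Proof.
move=> mA; rewrite -(haar_shift a mA) -haar_dilation //.
have := @measurable_affine 1 a (oner_neq0 _).
under eq_fun do rewrite mul1r.
by move=> m1; rewrite -[X in measurable X]setTI; exact: m1.
Qed.

End Scaling.
End Haar.

(** * The inner product of L^2(K) *)

Section InnerProduct.
Variables (R : realType) (K : fieldType) (abs : K -> R).
Variable mu : {measure set (Kmeas abs) -> \bar R}.
Local Notation C := (R[i]).
Local Notation KM := (Kmeas abs).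
Implicit Types f g h : K -> C.

Lemma Re_mul_conj (z w : C) : complex.Re (z * w^*) =
  complex.Re z * complex.Re w + complex.Im z * complex.Im w.
Proof. by case: z w => [a b] [a' b'] /=; rewrite mulrN opprK. Qed.

Lemma Im_mul_conj (z w : C) : complex.Im (z * w^*) =
  complex.Im z * complex.Re w - complex.Re z * complex.Im w.
Proof. by case: z w => [a b] [a' b'] /=; rewrite mulrN addrC. Qed.

Lemma sqn_ge0 (z : C) : 0 <= sqn z.
Proof. by rewrite addr_ge0 // sqr_ge0. Qed.

(** Expand (t a - s b)^2 / (2 t) >= 0 for s = 1 and s = -1, one for each sign of the product. *)
Lemma normr_mul_le (t a b : R) : 0 < t -> `|a * b| <= t / 2 * a ^+ 2 + t^-1 / 2 * b ^+ 2.
Proof.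
move=> t0.
have h s : 0 <= (t * a - s * b) ^+ 2 / t / 2.
  by rewrite !divr_ge0 ?sqr_ge0 // ltW.
have E s : (t * a - s * b) ^+ 2 / t / 2 =
    t / 2 * a ^+ 2 + s ^+ 2 * (t^-1 / 2 * b ^+ 2) - s * (a * b).
  by field; rewrite gt_eqF.
have := h 1; rewrite E expr1n !mul1r => h1.
have := h (-1); rewrite E sqrrN expr1n mulN1r mul1r => h2.
by rewrite ler_norml; apply/andP; split; lra.
Qed.

Lemma Re_mul_conj_le (t : R) (z w : C) : 0 < t ->
  `|complex.Re (z * w^*)| <= t * sqn z + t^-1 * sqn w.
Proof.
move=> t0; rewrite Re_mul_conj (le_trans (ler_normD _ _)) //.
have := normr_mul_le (complex.Re z) (complex.Re w) t0.
have := normr_mul_le (complex.Im z) (complex.Im w) t0.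
have t1 : 0 < t^-1 by rewrite invr_gt0.
have := mulr_ge0 (ltW t0) (sqn_ge0 z); have := mulr_ge0 (ltW t1) (sqn_ge0 w).
rewrite /sqn; lra.
Qed.

Lemma Im_mul_conj_le (t : R) (z w : C) : 0 < t ->
  `|complex.Im (z * w^*)| <= t * sqn z + t^-1 * sqn w.
Proof.
move=> t0; rewrite Im_mul_conj (le_trans (ler_normB _ _)) //.
have := normr_mul_le (complex.Re z) (complex.Im w) t0.
have := normr_mul_le (complex.Im z) (complex.Re w) t0.
have t1 : 0 < t^-1 by rewrite invr_gt0.
have := mulr_ge0 (ltW t0) (sqn_ge0 z); have := mulr_ge0 (ltW t1) (sqn_ge0 w).
rewrite /sqn; lra.
Qed.

Lemma measurable_sqn f : measurable_fun (setT : set KM) (fun x => complex.Re (f x)) ->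
  measurable_fun (setT : set KM) (fun x => complex.Im (f x)) ->
  measurable_fun (setT : set KM) (fun x => sqn (f x)).
Proof. by move=> mr mi; apply: measurable_funD; exact: measurable_funX. Qed.

Lemma L2_measurable_sqn f : L2 mu f ->
  measurable_fun (setT : set KM) (fun x => sqn (f x)).
Proof. by case=> mr [mi _]; exact: measurable_sqn. Qed.

Lemma L2_integrable f : L2 mu f ->
  mu.-integrable setT (EFin \o (fun x : KM => sqn (f x))).
Proof.
move=> fL; apply/integrableP; split.
  by apply/measurable_EFinP; exact: L2_measurable_sqn.
case: fL => _ [_]; rewrite /nrm2; apply: le_lt_trans.
rewrite le_eqVlt; apply/orP; left; apply/eqP; apply: eq_integral => x _ /=.
by rewrite ger0_norm // sqn_ge0.
Qed.

(** These functions serve as integrable majorants: for products of two L^2 functions, for the square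
    of a sum, and for the square of a multiple. *)
Lemma integrable_weighted (t s : R) f g : L2 mu f -> L2 mu g ->
  mu.-integrable setT (EFin \o (fun x : KM => t * sqn (f x) + s * sqn (g x))).
Proof.
move=> fL gL.
rewrite (_ : _ \o _ = (fun x => t%:E * (sqn (f x))%:E) \+ (fun x => s%:E * (sqn (g x))%:E))%E //.
by apply: integrableD => //; apply: integrableZl => //; exact: L2_integrable.
Qed.

Lemma measurable_Re_mul f g : L2 mu f -> L2 mu g ->
  measurable_fun (setT : set KM) (fun x => complex.Re (f x * (g x)^*)).
Proof.
move=> [fr [fi _]] [gr [gi _]]; under eq_fun do rewrite Re_mul_conj.
by apply: measurable_funD; exact: measurable_funM.
Qed.

Lemma measurable_Im_mul f g : L2 mu f -> L2 mu g ->
  measurable_fun (setT : set KM) (fun x => complex.Im (f x * (g x)^*)).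
Proof.
move=> [fr [fi _]] [gr [gi _]]; under eq_fun do rewrite Im_mul_conj.
by apply: measurable_funB; exact: measurable_funM.
Qed.

Lemma integrable_Re_mul f g : L2 mu f -> L2 mu g ->
  mu.-integrable setT (EFin \o (fun x : KM => complex.Re (f x * (g x)^*))).
Proof.
move=> fL gL; apply: (le_integrable measurableT _ _ (integrable_weighted 1 1^-1 fL gL)).
  by apply/measurable_EFinP; exact: measurable_Re_mul.
move=> x _ /=; rewrite lee_fin; apply: le_trans (ler_norm _).
by apply: Re_mul_conj_le.
Qed.

Lemma integrable_Im_mul f g : L2 mu f -> L2 mu g ->
  mu.-integrable setT (EFin \o (fun x : KM => complex.Im (f x * (g x)^*))).
Proof.
move=> fL gL; apply: (le_integrable measurableT _ _ (integrable_weighted 1 1^-1 fL gL)).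
  by apply/measurable_EFinP; exact: measurable_Im_mul.
move=> x _ /=; rewrite lee_fin; apply: le_trans (ler_norm _).
by apply: Im_mul_conj_le.
Qed.

Lemma Rintegral_weighted_le (t : R) (v : KM -> R) f g : L2 mu f -> L2 mu g ->
  mu.-integrable setT (EFin \o v) ->
  (forall x, `|v x| <= t * sqn (f x) + t^-1 * sqn (g x)) ->
  `|Rintegral mu setT v| <= t * fine (nrm2 mu f) + t^-1 * fine (nrm2 mu g).
Proof.
move=> fL gL iv vle; apply: (le_trans (le_normr_Rintegral _ iv)) => //.
have iZ (s : R) h : L2 mu h ->
    mu.-integrable setT (EFin \o (fun x : KM => s * sqn (h x))).
  by move=> hL; exact: (integrableZl measurableT s (L2_integrable hL)).
have -> : t * fine (nrm2 mu f) + t^-1 * fine (nrm2 mu g) =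
    Rintegral mu setT (fun x : KM => t * sqn (f x) + t^-1 * sqn (g x)).
  rewrite RintegralD //; [|exact: iZ|exact: iZ].
  by rewrite !RintegralZl //; exact: L2_integrable.
apply: le_Rintegral => //; last exact: integrable_weighted.
by have := integrable_norm iv.
Qed.

Lemma inner_Re_le (t : R) f g : 0 < t -> L2 mu f -> L2 mu g ->
  `|complex.Re (inner mu f g)| <= t * fine (nrm2 mu f) + t^-1 * fine (nrm2 mu g).
Proof.
move=> t0 fL gL; apply: Rintegral_weighted_le => //; first exact: integrable_Re_mul.
by move=> x; exact: Re_mul_conj_le.
Qed.

Lemma inner_Im_le (t : R) f g : 0 < t -> L2 mu f -> L2 mu g ->
  `|complex.Im (inner mu f g)| <= t * fine (nrm2 mu f) + t^-1 * fine (nrm2 mu g).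
Proof.
move=> t0 fL gL; apply: Rintegral_weighted_le => //; first exact: integrable_Im_mul.
by move=> x; exact: Im_mul_conj_le.
Qed.

Lemma complexP (z w : C) : complex.Re z = complex.Re w -> complex.Im z = complex.Im w -> z = w.
Proof. by case: z w => [a b] [a' b'] /= -> ->. Qed.

Lemma ReD (z w : C) : complex.Re (z + w) = complex.Re z + complex.Re w.
Proof. by case: z w => [a b] [a' b']. Qed.

Lemma ImD (z w : C) : complex.Im (z + w) = complex.Im z + complex.Im w.
Proof. by case: z w => [a b] [a' b']. Qed.

Lemma ReM (z w : C) : complex.Re (z * w) =
  complex.Re z * complex.Re w - complex.Im z * complex.Im w.
Proof. by case: z w => [a b] [a' b']. Qed.

Lemma ImM (z w : C) : complex.Im (z * w) =
  complex.Re z * complex.Im w + complex.Im z * complex.Re w.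
Proof. by case: z w => [a b] [a' b']. Qed.

Lemma L2D f g : L2 mu f -> L2 mu g -> L2 mu (fun x => f x + g x).
Proof.
move=> fL gL; have [fr [fi _]] := fL; have [gr [gi _]] := gL.
have mr : measurable_fun (setT : set KM) (fun x => complex.Re (f x + g x)).
  by under eq_fun do rewrite ReD; exact: measurable_funD.
have mi : measurable_fun (setT : set KM) (fun x => complex.Im (f x + g x)).
  by under eq_fun do rewrite ImD; exact: measurable_funD.
split=> //; split=> //.
(* The majorant comes from |z + w|^2 <= 2 |z|^2 + 2 |w|^2. *)
have /integrableP[_] := integrable_weighted 2 2 fL gL; apply: le_lt_trans.
apply: ge0_le_integral => //.
- by move=> x _; rewrite lee_fin sqn_ge0.
- by apply/measurable_EFinP; exact: measurable_sqn.
- apply/measurable_EFinP/measurableT_comp => //.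
  by apply: measurable_funD; apply: measurable_funM => //; exact: L2_measurable_sqn.
- move=> x _ /=; rewrite lee_fin; apply: le_trans (ler_norm _).
  rewrite /sqn ReD ImD.
  have := sqr_ge0 (complex.Re (f x) - complex.Re (g x)).
  have := sqr_ge0 (complex.Im (f x) - complex.Im (g x)).
  rewrite !sqrrB !sqrrD; lra.
Qed.

Lemma sqnM (z w : C) : sqn (z * w) = sqn z * sqn w.
Proof. by rewrite /sqn ReM ImM; ring. Qed.

Lemma L2Z (z : C) f : L2 mu f -> L2 mu (fun x => z * f x).
Proof.
move=> fL; have [fr [fi _]] := fL.
split.
  under eq_fun do rewrite ReM.
  by apply: measurable_funB; apply: measurable_funM.
split.
  under eq_fun do rewrite ImM.
  by apply: measurable_funD; apply: measurable_funM.
have := integrable_weighted (sqn z) 0 fL fL => /integrableP[_]; apply: le_lt_trans.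
rewrite le_eqVlt; apply/orP; left; apply/eqP; apply: eq_integral => x _ /=.
by rewrite sqnM mul0r addr0 ger0_norm // mulr_ge0 // sqn_ge0.
Qed.

Lemma L2_0 : L2 mu (fun _ => 0).
Proof.
split; first exact: measurable_cst.
split; first exact: measurable_cst.
rewrite /nrm2 integral0_eq // => x _.
by rewrite /sqn /= expr0n addr0.
Qed.

Lemma L2_sum (n : nat) (F : nat -> K -> C) :
  (forall i, L2 mu (F i)) -> L2 mu (fun x => \sum_(i < n) F i x).
Proof.
move=> FL; elim: n => [|n IH].
  by under eq_fun do rewrite big_ord0; exact: L2_0.
by under eq_fun do rewrite big_ord_recr /=; exact: L2D.
Qed.

Lemma innerDl f g h : L2 mu f -> L2 mu g -> L2 mu h ->
  inner mu (fun x => f x + g x) h = inner mu f h + inner mu g h.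
Proof.
move=> fL gL hL; apply: complexP; rewrite ?ReD ?ImD /=.
- rewrite -RintegralD //; [|exact: integrable_Re_mul|exact: integrable_Re_mul].
  by apply: eq_Rintegral => x _ /=; rewrite mulrDl ReD.
- rewrite -RintegralD //; [|exact: integrable_Im_mul|exact: integrable_Im_mul].
  by apply: eq_Rintegral => x _ /=; rewrite mulrDl ImD.
Qed.

Lemma innerZl (z : C) f h : L2 mu f -> L2 mu h ->
  inner mu (fun x => z * f x) h = z * inner mu f h.
Proof.
move=> fL hL.
have iR := integrable_Re_mul fL hL; have iI := integrable_Im_mul fL hL.
have iZ (s : R) (v : KM -> R) : mu.-integrable setT (EFin \o v) ->
    mu.-integrable setT (EFin \o (fun x => s * v x)).
  by move=> hv; exact: (integrableZl measurableT s hv).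
apply: complexP; rewrite ?ReM ?ImM /= -!RintegralZl //.
- rewrite -RintegralB //; [|exact: iZ|exact: iZ].
  by apply: eq_Rintegral => x _ /=; rewrite -mulrA ReM.
- rewrite -RintegralD //; [|exact: iZ|exact: iZ].
  by apply: eq_Rintegral => x _ /=; rewrite -mulrA ImM.
Qed.

Lemma Re_conj (z : C) : complex.Re z^* = complex.Re z.
Proof. by case: z. Qed.

Lemma Im_conj (z : C) : complex.Im z^* = - complex.Im z.
Proof. by case: z. Qed.

Lemma inner_conj f g : L2 mu f -> L2 mu g -> inner mu g f = (inner mu f g)^*.
Proof.
move=> fL gL; apply: complexP; rewrite ?Re_conj ?Im_conj /=.
- by apply: eq_Rintegral => x _; rewrite !Re_mul_conj; congr (_ + _); exact: mulrC.
- rewrite -mulN1r -RintegralZl //; last exact: integrable_Im_mul.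
  by apply: eq_Rintegral => x _; rewrite !Im_mul_conj mulN1r opprB; congr (_ - _); exact: mulrC.
Qed.

Lemma inner_suml (n : nat) (F : nat -> K -> C) h :
  (forall i, L2 mu (F i)) -> L2 mu h ->
  inner mu (fun x => \sum_(i < n) F i x) h = \sum_(i < n) inner mu (F i) h.
Proof.
move=> FL hL; elim: n => [|n IH].
  rewrite big_ord0.
  have -> : (fun x : K => \sum_(i < 0) F i x) = (fun x => 0 * (fun _ : K => 0) x).
    by apply/funext => x; rewrite big_ord0 mul0r.
  by rewrite innerZl ?mul0r //; exact: L2_0.
under eq_fun do rewrite big_ord_recr /=.
by rewrite innerDl // ?IH ?big_ord_recr //; exact: L2_sum.
Qed.

End InnerProduct.

(** * Change of variables for a map that scales the measure by a constant *)

Section ChangeOfVariables.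
Variables (R : realType) (K : fieldType) (abs : K -> R).
Variable mu : {measure set (Kmeas abs) -> \bar R}.
Local Notation C := (R[i]).
Local Notation KM := (Kmeas abs).
Variables (T : KM -> KM) (s : R).
Hypotheses (mT : measurable_fun setT T) (s_ge0 : 0 <= s).
Hypothesis muT : forall A : set KM, measurable A -> mu (T @^-1` A) = (s%:E * mu A)%E.
Implicit Types f g : K -> C.

(** The left side is the integral of h against the pushforward of [mu], which by [muT] is s times
    [mu]. *)
Lemma ge0_integral_comp (h : KM -> \bar R) : measurable_fun setT h ->
  (forall x, (0 <= h x)%E) ->
  (\int[mu]_x h (T x) = s%:E * \int[mu]_x h x)%E.
Proof.
move=> mh h0; transitivity (\int[pushforward mu T]_x h x)%E.
  by rewrite (ge0_integral_pushforward mT) // preimage_setT.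
rewrite (eq_measure_integral (mscale (NngNum s_ge0) mu)); last first.
  by move=> A mA _; exact: muT.
by rewrite ge0_integral_mscale.
Qed.

Lemma L2_comp f : L2 mu f -> L2 mu (fun x => f (T x)).
Proof.
move=> fL; have [fr [fi fn]] := fL.
split; first by move: (measurableT_comp fr mT).
split; first by move: (measurableT_comp fi mT).
rewrite /nrm2 (@ge0_integral_comp (fun x => (sqn (f x))%:E)).
- by rewrite lte_mul_pinfty // lee_fin.
- by apply/measurable_EFinP; exact: L2_measurable_sqn fL.
- by move=> x; rewrite lee_fin sqn_ge0.
Qed.

(** Positive and negative parts reduce this to the nonnegative case; integrability makes both
    integrals finite, so s factors out of the real difference. *)
Lemma Rintegral_comp (v : KM -> R) : mu.-integrable setT (EFin \o v) ->
  Rintegral mu setT (fun x => v (T x)) = s * Rintegral mu setT v.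
Proof.
move=> iv; have mv := measurable_int _ iv.
have vpos := integrable_funepos measurableT iv.
have vneg := integrable_funeneg measurableT iv.
have fp := integrable_fin_num measurableT vpos.
have fn := integrable_fin_num measurableT vneg.
rewrite /Rintegral integralE [in RHS]integralE.
transitivity (fine (s%:E * \int[mu]_x (EFin \o v)^\+ x -
    s%:E * \int[mu]_x (EFin \o v)^\- x)%E); last first.
  by rewrite -(fineK fn) -(fineK fp) /= mulrBr.
congr (fine (_ - _)).
- rewrite -ge0_integral_comp //; last exact: measurable_funepos.
  by apply: eq_integral => x _; rewrite !funeposE.
- rewrite -ge0_integral_comp //; last exact: measurable_funeneg.
  by apply: eq_integral => x _; rewrite !funenegE.
Qed.

Lemma inner_comp f g : L2 mu f -> L2 mu g ->
  inner mu (fun x => f (T x)) (fun x => g (T x)) = s%:C%C * inner mu f g.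
Proof.
move=> fL gL; apply: complexP; rewrite ?ReM ?ImM /= mul0r ?subr0 ?addr0.
- by rewrite -Rintegral_comp //; exact: integrable_Re_mul.
- by rewrite -Rintegral_comp //; exact: integrable_Im_mul.
Qed.

End ChangeOfVariables.

(** * Passing to L^2 limits in inner products *)

Section InnerLimits.
Variables (R : realType) (K : fieldType) (abs : K -> R).
Variable mu : {measure set (Kmeas abs) -> \bar R}.
Local Notation C := (R[i]).
Implicit Types f g : K -> C.

Lemma L2_limP (S : nat -> K -> C) f (e : R) : L2_lim mu S f -> 0 < e ->
  \forall n \near \oo, fine (nrm2 mu (fun x => S n x - f x)) < e.
Proof.
move=> /fine_cvgP[_ /cvgrPdist_lt/(_ e)] H e0.
near=> n; apply: le_lt_trans (ler_norm _) _.
by rewrite -normrN -sub0r; near: n; exact: H.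
Unshelve. all: by end_near. Qed.

(* The parameter [t] of the weighted bound replaces Cauchy-Schwarz: it is fixed
   first, so as to make the term in [B] small, before [n] is chosen. *)
Lemma weighted_bound_eq0 (x B : R) (u v : nat -> R) : 0 <= B ->
  (forall e, 0 < e -> \forall n \near \oo, u n < e) ->
  (forall e, 0 < e -> \forall n \near \oo, v n < e) ->
  (forall t n, 0 < t -> `|x| <= t * (u n + v n) + t^-1 * B) -> x = 0.
Proof.
move=> B0 u0 v0 H; apply/eqP; rewrite -normr_le0; apply/ler_addgt0Pr => e e0.
rewrite add0r.
(* This weight gives B / t <= e / 2; using B + 1 keeps t positive when B = 0. *)
pose t := 2 * (B + 1) / e.
have B1 : 0 < B + 1 by rewrite ltr_wpDl.
have t0 : 0 < t by rewrite divr_gt0 // mulr_gt0.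
have d0 : 0 < e / 4 / t by rewrite divr_gt0 // divr_gt0 // ltr0n.
near \oo => n.
apply: (le_trans (H t n t0)).
have un : u n < e / 4 / t by near: n; exact: u0.
have vn : v n < e / 4 / t by near: n; exact: v0.
have h1 : t * (u n + v n) <= e / 2.
  have -> : e / 2 = t * (e / 4 / t + e / 4 / t) by field; rewrite gt_eqF.
  by rewrite ler_pM2l // lerD // ltW.
have h2 : t^-1 * B <= e / 2.
  have te : t * (e / 2) = B + 1 by rewrite /t; field; rewrite gt_eqF.
  by rewrite ler_pdivrMl // te lerDl.
lra.
Unshelve. all: by end_near. Qed.

Lemma inner_lim_eq (S S' : nat -> K -> C) f f' g g' :
  L2_lim mu S f -> L2_lim mu S' f' ->
  (forall n, L2 mu (S n)) -> (forall n, L2 mu (S' n)) ->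
  L2 mu f -> L2 mu f' -> L2 mu g -> L2 mu g' ->
  (forall n, inner mu (S n) g = inner mu (S' n) g') ->
  inner mu f g = inner mu f' g'.
Proof.
move=> Sf Sf' SL SL' fL fL' gL gL' E.
have L2B h k : L2 mu h -> L2 mu k -> L2 mu (fun x => h x - k x).
  move=> hL kL; under eq_fun do rewrite -mulN1r.
  by apply: L2D => //; exact: L2Z.
have innerB h k l : L2 mu h -> L2 mu k -> L2 mu l ->
    inner mu (fun x => h x - k x) l = inner mu h l - inner mu k l.
  move=> hL kL lL; under eq_fun do rewrite -mulN1r.
  by rewrite innerDl ?innerZl ?mulN1r //; exact: L2Z.
(* The terms in [S n] and [S' n] cancel by [E], leaving two errors that tend to 0. *)
have Ez n : inner mu f' g' - inner mu f g =
    inner mu (fun x => S n x - f x) g - inner mu (fun x => S' n x - f' x) g'.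
  by rewrite !innerB // E; ring.
have ReB (z w : C) : complex.Re (z - w) = complex.Re z - complex.Re w.
  by case: z w => [? ?] [? ?].
have ImB (z w : C) : complex.Im (z - w) = complex.Im z - complex.Im w.
  by case: z w => [? ?] [? ?].
have n0 h : 0 <= fine (nrm2 mu h).
  by apply: fine_ge0; apply: integral_ge0 => x _; rewrite lee_fin sqn_ge0.
apply/esym/eqP; rewrite -subr_eq0; apply/eqP.
have lim0 := L2_limP Sf; have lim0' := L2_limP Sf'.
have bound t n (x y : R) : `|x| <= t * fine (nrm2 mu (fun x => S n x - f x)) +
      t^-1 * fine (nrm2 mu g) ->
    `|y| <= t * fine (nrm2 mu (fun x => S' n x - f' x)) + t^-1 * fine (nrm2 mu g') ->
    `|x - y| <= t * (fine (nrm2 mu (fun x => S n x - f x)) +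
      fine (nrm2 mu (fun x => S' n x - f' x))) +
      t^-1 * (fine (nrm2 mu g) + fine (nrm2 mu g')).
  by move=> hx hy; rewrite (le_trans (ler_normB _ _)) // !mulrDr addrACA lerD.
apply: complexP.
- apply: (weighted_bound_eq0 (addr_ge0 (n0 g) (n0 g')) (fun e => lim0 e) (fun e => lim0' e)).
  move=> t n t0; rewrite (Ez n) ReB.
  by apply: bound; apply: inner_Re_le => //; exact: L2B.
- apply: (weighted_bound_eq0 (addr_ge0 (n0 g) (n0 g')) (fun e => lim0 e) (fun e => lim0' e)).
  move=> t n t0; rewrite (Ez n) ImB.
  by apply: bound; apply: inner_Im_le => //; exact: L2B.
Qed.

(** One slot at a time: the first limit is taken with g fixed, then conjugate symmetry brings the
    second slot to the front while n is fixed. *)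
Lemma inner_lim2_eq (S S' T T' : nat -> K -> C) f f' g g' :
  L2_lim mu S f -> L2_lim mu S' f' -> L2_lim mu T g -> L2_lim mu T' g' ->
  (forall n, L2 mu (S n)) -> (forall n, L2 mu (S' n)) ->
  (forall n, L2 mu (T n)) -> (forall n, L2 mu (T' n)) ->
  L2 mu f -> L2 mu f' -> L2 mu g -> L2 mu g' ->
  (forall n m, inner mu (S n) (T m) = inner mu (S' n) (T' m)) ->
  inner mu f g = inner mu f' g'.
Proof.
move=> Sf Sf' Tg Tg' SL SL' TL TL' fL fL' gL gL' E.
apply: (inner_lim_eq Sf Sf') => // n.
rewrite (inner_conj gL (SL n)) (inner_conj gL' (SL' n)); congr (_^*).
apply: (inner_lim_eq Tg Tg') => // m.
by rewrite (inner_conj (SL n) (TL m)) E -inner_conj.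
Qed.

End InnerLimits.

(** * Refinement equations *)

Section Refinement.
Variables (R : realType) (K : fieldType) (p c : nat) (abs : K -> R) (pr : K).
Variables (zeta : nat -> K) (mu : {measure set (Kmeas abs) -> \bar R}).
Hypothesis lf : local_field_pchar p c abs pr zeta.
Hypothesis haar_mu : haar_normalized mu.
Local Notation C := (R[i]).
Local Notation q := (p ^ c)%N.
Local Notation u := (uK p c pr zeta).
Implicit Types f g h : K -> C.

Let measurable_shift (b : K) :
  measurable_fun setT (fun x : Kmeas abs => x - b : Kmeas abs).
Proof.
have := measurable_affine lf b (oner_neq0 K).
by under eq_fun do rewrite mul1r.
Qed.

Let measurable_dilate (b : K) :
  measurable_fun setT (fun x : Kmeas abs => pr^-1 * x - b : Kmeas abs).
Proof. by apply: (measurable_affine lf); rewrite invr_eq0 (lf_pr_neq0 lf). Qed.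

Let mu_shift (b : K) (A : set (Kmeas abs)) : measurable A ->
  mu ((fun x => x - b) @^-1` A) = (1%:E * mu A)%E.
Proof. by move=> mA; rewrite mul1e (haar_shift haar_mu). Qed.

Let abs_pr_ge0 : 0 <= abs pr.
Proof. exact: lf_abs_ge0 lf pr. Qed.

Lemma L2_transl f (b : K) : L2 mu f -> L2 mu (transl f b).
Proof. exact: (L2_comp (measurable_shift b) ler01 (mu_shift b)). Qed.

Lemma inner_transl f g (b : K) : L2 mu f -> L2 mu g ->
  inner mu (transl f b) (transl g b) = inner mu f g.
Proof.
move=> fL gL; have := inner_comp (measurable_shift b) ler01 (mu_shift b) fL gL.
by rewrite mul1r.
Qed.

Lemma L2_affine f (b : K) : L2 mu f -> L2 mu (fun x => f (pr^-1 * x - b)).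
Proof.
exact: (L2_comp (measurable_dilate b) abs_pr_ge0 (haar_affine lf haar_mu b)).
Qed.

Lemma inner_affine f g (b d : K) : L2 mu f -> L2 mu g ->
  inner mu (fun x => f (pr^-1 * x - b)) (fun x => g (pr^-1 * x - d)) =
  (abs pr)%:C%C * inner mu f (transl g (d - b)).
Proof.
move=> fL gL.
rewrite -(inner_comp (measurable_dilate b) abs_pr_ge0 (haar_affine lf haar_mu b)) //;
  last exact: L2_transl.
congr inner; apply/funext => x; rewrite /transl; congr g.
by rewrite opprB addrA subrK.
Qed.

Lemma L2_refine_sum (a : nat -> C) f N : L2 mu f -> L2 mu (refine_sum q pr u a f N).
Proof.
move=> fL; apply: L2Z; apply: (@L2_sum _ _ _ _ _ (fun i x => a i * f (pr^-1 * x - u i))).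
by move=> i; apply: L2Z; exact: L2_affine.
Qed.

Lemma inner_refine_suml (a : nat -> C) f g N : L2 mu f -> L2 mu g ->
  inner mu (refine_sum q pr u a f N) g = (Num.sqrt (q%:R : R))%:C%C *
    \sum_(i < N) a i * inner mu (fun x => f (pr^-1 * x - u i)) g.
Proof.
move=> fL gL; have fiL i : L2 mu (fun x => a i * f (pr^-1 * x - u i)).
  by apply: L2Z; exact: L2_affine.
rewrite innerZl //; last exact: (L2_sum _ fiL).
rewrite (inner_suml _ fiL) //; congr (_ * _); apply: eq_bigr => i _.
by rewrite innerZl //; exact: L2_affine.
Qed.

(** Once the coefficients are fixed, f and g enter only through inner products of f with translates
    of g. The nested conjugations come from expanding the second slot by conjugate symmetry. *)
Lemma inner_refine_sum (a a' : nat -> C) f g (b : K) N M : L2 mu f -> L2 mu g ->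
  inner mu (refine_sum q pr u a f N) (transl (refine_sum q pr u a' g M) b) =
  (Num.sqrt (q%:R : R))%:C%C * \sum_(i < N) a i *
    ((Num.sqrt (q%:R : R))%:C%C * \sum_(j < M) a' j *
      ((abs pr)%:C%C * inner mu f (transl g (pr^-1 * b + u j - u i)))^*)^*.
Proof.
move=> fL gL; have GL := L2_transl b (L2_refine_sum a' M gL).
rewrite inner_refine_suml //; congr (_ * _); apply: eq_bigr => i _; congr (_ * _).
have FL := L2_affine (u i) fL.
rewrite (inner_conj GL FL); congr (_^*).
(* Translating both slots by -b frees the refinement sum and puts the shift, now pr^-1 b, into the
   argument of f. *)
rewrite -(inner_transl (- b)) //.
rewrite (_ : transl (transl _ b) (- b) = refine_sum q pr u a' g M); last first.
  by apply/funext => x; rewrite /transl opprK addrK.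
rewrite inner_refine_suml //; last exact: L2_transl.
congr (_ * _); apply: eq_bigr => j _; congr (_ * _).
rewrite inner_conj; [|exact: L2_transl|exact: L2_affine].
congr (_^*).
rewrite (_ : transl _ (- b) = fun x => f (pr^-1 * x - (u i - pr^-1 * b))); last first.
  by apply/funext => x; rewrite /transl opprK mulrDr opprB; congr f; ring.
rewrite inner_affine //; congr (_ * inner mu f (transl g _)); ring.
Qed.

Lemma nrm2_transl h (b : K) : L2 mu h -> nrm2 mu (transl h b) = nrm2 mu h.
Proof.
move=> hL; rewrite -[RHS]mul1e.
apply: (ge0_integral_comp (measurable_shift b) ler01 (mu_shift b)).
- by apply/measurable_EFinP; exact: L2_measurable_sqn hL.
- by move=> x; rewrite lee_fin sqn_ge0.
Qed.

Lemma L2_lim_transl (S : nat -> K -> C) f (b : K) :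
  (forall n, L2 mu (S n)) -> L2 mu f -> L2_lim mu S f ->
  L2_lim mu (fun n => transl (S n) b) (transl f b).
Proof.
move=> SL fL Sf; rewrite /L2_lim.
have E n : nrm2 mu (fun x => transl (S n) b x - transl f b x) =
    nrm2 mu (fun x => S n x - f x).
  rewrite -[RHS](nrm2_transl b) //; under eq_fun do rewrite -mulN1r.
  by apply: L2D => //; exact: L2Z.
by under eq_fun do rewrite E.
Qed.

(** The translations met in [inner_refine_sum] for b = u k are again values of u, because these form
    a group stable under pr^-1. *)
Lemma uK_affine (k i j : nat) : exists m, u m = pr^-1 * u k + u j - u i.
Proof.
have p0 := prime_gt0 (lf_prime lf).
have q1 := card_residue_gt1 lf.
have ch := lf_char lf.
have [k' <-] := uK_shift pr zeta q1 k.
have [m um] := uKD pr zeta p0 q1 ch k' j.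
have [n un] := uKN pr zeta p0 q1 ch i.
by have [t ut] := uKD pr zeta p0 q1 ch m n; exists t; rewrite ut um un.
Qed.

(* Both sides are limits of the same expression in the inner products of
   [f] (resp. [f2]) with the translates of [g] (resp. [g2]). *)
Lemma refinement_inner_eq (a a' : nat -> C) f g f2 g2 F G F2 G2 (k : nat) :
  L2 mu f -> L2 mu g -> L2 mu f2 -> L2 mu g2 ->
  L2 mu F -> L2 mu G -> L2 mu F2 -> L2 mu G2 ->
  refinement mu q pr u F a f -> refinement mu q pr u G a' g ->
  refinement mu q pr u F2 a f2 -> refinement mu q pr u G2 a' g2 ->
  (forall m, inner mu f (transl g (u m)) = inner mu f2 (transl g2 (u m))) ->
  inner mu F (transl G (u k)) = inner mu F2 (transl G2 (u k)).
Proof.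
move=> fL gL f2L g2L FL GL F2L G2L rF rG rF2 rG2 E.
have sL b h N : L2 mu h -> L2 mu (refine_sum q pr u b h N) by exact: L2_refine_sum.
apply: (inner_lim2_eq rF rF2 (L2_lim_transl (u k) _ GL rG) (L2_lim_transl (u k) _ G2L rG2));
  do ?[by move=> *; apply: sL | by move=> *; apply: L2_transl => //; apply: sL
      | exact: L2_transl | by []].
move=> n m; rewrite !inner_refine_sum //.
congr (_ * _); apply: eq_bigr => i _; congr (_ * (_ * _)^*).
apply: eq_bigr => j _; congr (_ * (_ * _)^*).
by have [t <-] := uK_affine k i j.
Qed.

Lemma refinement0 (a : nat -> C) : refinement mu q pr u (fun _ => 0) a (fun _ => 0).
Proof.
rewrite /refinement /L2_lim (_ : (fun _ => _) = cst 0%E); first exact: cvg_cst.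
apply/funext => n; rewrite /nrm2 integral0_eq // => x _.
rewrite /refine_sum big1 ?mulr0 ?subr0; last by move=> i _; rewrite mulr0.
by rewrite /sqn /= expr0n addr0.
Qed.

Lemma inner0l g : L2 mu g -> inner mu (fun _ => 0) g = 0.
Proof.
move=> gL; have := innerZl 0 (L2_0 mu) gL.
by under eq_fun do rewrite mul0r; rewrite mul0r.
Qed.

(** Comparison with the zero function, which refines itself with any coefficients. *)
Lemma refinement_inner_eq0 (a a' : nat -> C) f g F G (k : nat) :
  L2 mu f -> L2 mu g -> L2 mu F -> L2 mu G ->
  refinement mu q pr u F a f -> refinement mu q pr u G a' g ->
  (forall m, inner mu f (transl g (u m)) = 0) -> inner mu F (transl G (u k)) = 0.
Proof.
move=> fL gL FL GL rF rG E; have L0 := L2_0 mu.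
rewrite (@refinement_inner_eq a a' f g (fun _ => 0) g F G (fun _ => 0) G) //.
- by rewrite inner0l //; exact: L2_transl.
- exact: refinement0.
- by move=> m; rewrite E inner0l //; exact: L2_transl.
Qed.

End Refinement.

(** * Biorthogonality of the wavelet packets *)

Unset Implicit Arguments.

Theorem theorem3p4 (R : realType) (K : fieldType) (p c : nat) (abs : K -> R)
  (pr : K) (zeta : nat -> K) (mu : {measure set (Kmeas abs) -> \bar R})
  (a a' : nat -> nat -> R[i]) (phi phi' : K -> R[i]) (psi psi' : nat -> K -> R[i])
  (omega omega' : nat -> K -> R[i]) :
  local_field_pchar p c abs pr zeta ->
  haar_normalized mu ->
  let q := (p ^ c)%N in
  let u := uK p c pr zeta in
  (* phi, phi~, psi_l, psi~_l in L^2(K), coefficients in l^2(N_0) *)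
  L2 mu phi -> L2 mu phi' ->
  (forall l, (1 <= l <= q - 1)%N -> L2 mu (psi l) /\ L2 mu (psi' l)) ->
  (forall s, (s <= q - 1)%N -> l2seq (a s) /\ l2seq (a' s)) ->
  (* refinement equations *)
  refinement mu q pr u phi (a 0%N) phi ->
  refinement mu q pr u phi' (a' 0%N) phi' ->
  (forall l, (1 <= l <= q - 1)%N ->
     refinement mu q pr u (psi l) (a l) phi /\
     refinement mu q pr u (psi' l) (a' l) phi') ->
  (* phi is the scaling function of an MRA {V_j}, and the translates of the
     psi_l form a Riesz basis of a direct complement W_0 of V_0 in V_1 *)
  (exists (V : int -> set (K -> R[i])) (W0 : set (K -> R[i])),
     [/\ MRA mu pr u V phi, direct_complement mu W0 (V 0%R) (V 1%R) &
         riesz_basis mu (fun lk : nat * nat => (1 <= lk.1 <= q - 1)%N)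
           (fun lk : nat * nat => transl (psi lk.1) (u lk.2)) W0]) ->
  (* biorthogonality *)
  (forall k, inner mu phi (transl phi' (u k)) = (if k == 0%N then 1 else 0)) ->
  (forall k l, (1 <= l <= q - 1)%N -> inner mu phi (transl (psi' l) (u k)) = 0) ->
  (forall k l, (1 <= l <= q - 1)%N -> inner mu phi' (transl (psi l) (u k)) = 0) ->
  (forall k l l', (1 <= l <= q - 1)%N -> (1 <= l' <= q - 1)%N ->
     inner mu (psi l) (transl (psi' l') (u k)) =
       (if (l == l') && (k == 0%N) then 1 else 0)) ->
  (* the wavelet packets *)
  omega 0%N = phi -> omega' 0%N = phi' ->
  (forall n, L2 mu (omega n) /\ L2 mu (omega' n)) ->
  (forall r s, (s <= q - 1)%N ->
     refinement mu q pr u (omega (q * r + s)%N) (a s) (omega r) /\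
     refinement mu q pr u (omega' (q * r + s)%N) (a' s) (omega' r)) ->
  forall l n k : nat,
    inner mu (omega l) (transl (omega' n) (u k)) =
      (if (l == n) && (k == 0%N) then 1 else 0).
Proof.
move=> lf haar_mu q u phiL phi'L psiL _ rphi rphi' rpsi _ bphi bphipsi bphi'psi bpsi
  om0 om0' omL rom.
have p0 := prime_gt0 (lf_prime lf); have q1 : (1 < q)%N := card_residue_gt1 lf.
have q0 : (0 < q)%N := ltnW q1.
(* Placing phi at index 0 before the psi_s puts all q refinement equations and all biorthogonality
   relations in one form. *)
pose P (s : nat) := if s == 0%N then phi else psi s.
pose P' (s : nat) := if s == 0%N then phi' else psi' s.
have bnd s : (s < q)%N -> s != 0%N -> (1 <= s <= q - 1)%N.
  by move=> sq s0; rewrite lt0n s0 subn1 -ltnS prednK.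
have PL s : (s < q)%N -> L2 mu (P s) /\ L2 mu (P' s).
  by move=> sq; rewrite /P /P'; case: (eqVneq s 0%N) => // s0; exact/psiL/bnd.
have rP s : (s < q)%N ->
    refinement mu q pr u (P s) (a s) phi /\ refinement mu q pr u (P' s) (a' s) phi'.
  by move=> sq; rewrite /P /P'; case: (eqVneq s 0%N) => [->|s0] //; exact/rpsi/bnd.
have bP s t k : (s < q)%N -> (t < q)%N -> inner mu (P s) (transl (P' t) (u k)) =
    if (s == t) && (k == 0%N) then 1 else 0.
  move=> sq tq; rewrite /P /P'.
  have [->|s0] := eqVneq s 0%N; have [t0|t0] := eqVneq t 0%N.
  - by rewrite ?t0 bphi.
  - by rewrite bphipsi // bnd.
  - rewrite t0 (negbTE s0) /=.
    have [psL _] := psiL _ (bnd _ sq s0).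
    (* The hypothesis concerns phi' against translates of psi_s. Writing -u k = u k' moves the
       translation to psi_s, and conjugation exchanges the slots. *)
    have [k' uk'] := uKN pr zeta p0 q1 (lf_char lf) k.
    have -> : psi s = transl (transl (psi s) (u k')) (u k).
      by apply/funext => x; rewrite /transl /u uk' opprK subrK.
    rewrite (inner_transl lf haar_mu) //; last exact: (L2_transl lf haar_mu).
    rewrite (inner_conj phi'L); last exact: (L2_transl lf haar_mu).
    by rewrite bphi'psi ?rmorph0 // bnd.
  - by rewrite bpsi // bnd.
move=> l n k; have [b] := ubnP (l + n)%N; elim: b l n k => // b IH l n k lnb.
have [/eqP|ln0] := posnP (l + n).
  by rewrite addn_eq0 => /andP[/eqP-> /eqP->]; rewrite om0 om0' bphi.
(* As q > 1, a positive index strictly decreases under division by q, and the other one does not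
   grow. *)
have lt_ln : (l %/ q + n %/ q < l + n)%N.
  case: (posnP l) ln0 => [->|l0 _].
    by rewrite div0n !add0n => n0; exact: ltn_Pdiv.
  by rewrite -addSn leq_add ?ltn_Pdiv ?leq_div.
have IHr m : inner mu (omega (l %/ q)%N) (transl (omega' (n %/ q)%N) (u m)) =
    if (l %/ q == n %/ q)%N && (m == 0%N) then 1 else 0.
  by apply: IH; exact: leq_trans lt_ln lnb.
have lq : (l %% q < q)%N by rewrite ltn_mod.
have nq : (n %% q < q)%N by rewrite ltn_mod.
have [rl _] := rom (l %/ q)%N (l %% q)%N (ltac:(by rewrite subn1 -ltnS prednK)).
have [_ rn] := rom (n %/ q)%N (n %% q)%N (ltac:(by rewrite subn1 -ltnS prednK)).
rewrite mulnC -divn_eq in rl; rewrite mulnC -divn_eq in rn.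
have L m := (omL m).1; have L' m := (omL m).2.
case: (eqVneq (l %/ q)%N (n %/ q)%N) IHr => [Eq|Neq] /= IHr.
- have [Pl _] := PL _ lq; have [_ Pn] := PL _ nq.
  have [rPl _] := rP _ lq; have [_ rPn] := rP _ nq.
  transitivity (inner mu (P (l %% q)%N) (transl (P' (n %% q)%N) (u k))).
    apply: (refinement_inner_eq lf haar_mu k (L _) (L' _) phiL phi'L (L _) (L' _)
      Pl Pn rl rn rPl rPn).
    (* With equal quotients, both families of inner products are the Kronecker delta at m = 0. *)
    by move=> m; rewrite IHr bphi.
  (* For equal quotients, l = n exactly when the remainders agree. *)
  rewrite bP //; congr (if _ && _ then _ else _).
  by rewrite [in RHS](divn_eq l q) [in RHS](divn_eq n q) Eq eqn_add2l.
- have -> : (l == n) = false by apply/eqP => ln; rewrite ln eqxx in Neq.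
  exact: (refinement_inner_eq0 lf haar_mu k (L _) (L' _) (L _) (L' _) rl rn).
Qed.
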